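(* Let $k \geq 1$ be an integer and let $E_k = \gcd(2^k-1, k)$. Then there exist a positive integer $W(k)$ and a number $N_0(k)$ such that every multiple $N$ of $E_k$ with $N > N_0(k)$ can be written as a sum of at most $W(k)$ binary $k$'th powers.
   Context: For integers $k,n \geq 1$ let $c_k(n) := \frac{2^{kn}-1}{2^n-1} = 1 + 2^n + \cdots + 2^{(k-1)n}$. A natural number is a binary $k$'th power if its canonical binary representation (no leading zeros) consists of $k$ consecutive identical blocks; equivalently, it is $0$ or of the form $a \cdot c_k(n)$ with $n \geq 1$ and $2^{n-1} \leq a < 2^n$. Sums may use the same binary $k$'th power several times. *)

(* Defs.v *)
From mathcomp Require Import all_boot.
Set Implicit Arguments.
Unset Strict Implicit.
Unset Printing Implicit Defensive.

(* Binary words are read most significant bit first. *)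
Definition bin_val (s : bitseq) : nat :=
  foldl (fun (m : nat) (b : bool) => m.*2 + b) 0 s.

(* No leading zero: the first bit, if any, is 1; the canonical representation
   of 0 is the empty word. *)
Definition canonical_binary (s : bitseq) (N : nat) : bool :=
  head true s && (bin_val s == N).

Definition binary_power (k N : nat) : Prop :=
  exists w : bitseq, canonical_binary (flatten (nseq k w)) N.

Definition repunit (k n : nat) : nat := \sum_(i < k) 2 ^ (i * n).

Lemma bin_val_rcons (s : bitseq) (b : bool) :
  bin_val (rcons s b) = (bin_val s).*2 + b.
Proof. by rewrite /bin_val -cats1 foldl_cat. Qed.

Lemma bin_val_cat (s t : bitseq) :
  bin_val (s ++ t) = bin_val s * 2 ^ size t + bin_val t.
Proof.
elim/last_ind: t => [|t b IH]; first by rewrite cats0 muln1 addn0.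
rewrite -rcons_cat !bin_val_rcons IH size_rcons expnS doubleD addnA.
by rewrite -!mul2n mulnCA.
Qed.

Lemma bin_val_lt (s : bitseq) : bin_val s < 2 ^ size s.
Proof.
elim/last_ind: s => [//|s b IH].
rewrite bin_val_rcons size_rcons expnS.
apply: (@leq_trans (2 * (bin_val s).+1)); last by rewrite leq_mul2l.
by rewrite mulnS -mul2n addnC ltn_add2r; case: b.
Qed.

Lemma bin_val_cons1 (w : bitseq) :
  bin_val (true :: w) = 2 ^ size w + bin_val w.
Proof. by rewrite -cat1s bin_val_cat mul1n. Qed.

Lemma bin_val_surj (n a : nat) :
  a < 2 ^ n -> exists2 w : bitseq, size w = n & bin_val w = a.
Proof.
elim: n a => [|n IH] a; first by case: a => // _; exists [::].
rewrite expnS => ha.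
have /IH [w sw vw] : a./2 < 2 ^ n.
  by rewrite ltn_half_double -mul2n.
exists (rcons w (odd a)); first by rewrite size_rcons sw.
by rewrite bin_val_rcons vw addnC odd_double_half.
Qed.

Lemma bin_val_rep (k : nat) (w : bitseq) :
  bin_val (flatten (nseq k w)) = bin_val w * repunit k (size w).
Proof.
elim: k => [|k IH]; first by rewrite /repunit big_ord0 muln0.
rewrite /= bin_val_cat IH /repunit big_ord_recr /= mulnDr addnC; congr (_ + _ * 2 ^ _).
by rewrite size_flatten /shape map_nseq sumn_nseq mulnC.
Qed.

Lemma repunitE (k n : nat) : 0 < n -> repunit k n = (2 ^ (k * n) - 1) %/ (2 ^ n - 1).
Proof.
move=> n0; have hn : 1 < 2 ^ n by rewrite -{1}(expn0 2) ltn_exp2l.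
rewrite mulnC expnM subn1 predn_exp subn1 mulKn; last by case: (2 ^ n) hn => [|[]].
by apply: eq_bigr => i _; rewrite mulnC expnM.
Qed.

Lemma binary_powerP (k N : nat) : 0 < k ->
  binary_power k N <->
  N = 0 \/ exists n a : nat,
    [/\ 1 <= n, 2 ^ (n - 1) <= a < 2 ^ n & N = a * repunit k n].
Proof.
case: k => // k _; split.
- case=> [[|b w]] /andP [] hh /eqP <-; rewrite bin_val_rep; first by left.
  right; exists (size (b :: w)), (bin_val (b :: w)); split=> //.
  rewrite bin_val_lt andbT.
  by move: hh => /= ->; rewrite bin_val_cons1 subn1 leq_addr.
- case=> [->|[n [a [n1 /andP [la ua] ->]]]].
    by exists [::]; rewrite /canonical_binary bin_val_rep; elim: k.
  have [w sw vw] := bin_val_surj ua.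
  exists w; rewrite /canonical_binary bin_val_rep sw vw eqxx andbT.
  case: w sw vw => [|[] w] sw vw //=; first by rewrite -sw in n1.
  have := bin_val_lt w; have -> : bin_val w = a by [].
  by move: la; rewrite -sw /= subn1 leqNgt => /negP.
Qed.

(* Main.v *)
Require Import Defs.
From mathcomp Require Import all_boot all_algebra.
From mathcomp Require Import cyclic ring zify.
Import GRing.Theory.

(* Write X = 2^n and c_i = repunit k (n + i) for i < k. Inverting a Vandermonde
   matrix independent of n, some fixed D > 0 makes each D X^j an integer
   combination of the c_i with bounded coefficients; so D Q, for Q = O(X^k), is
   a combination of the c_i with coefficients O(X), as one sees by writing Q in
   base X. If moreover D! divides n, any common divisor g of D, c_0 and c_1 is
   odd, so 2^n = 1 mod g, and g divides both k and 2^k - 1; hence every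
   multiple N of E_k is congruent mod D to a combination of c_0, c_1 with
   coefficients in [0, D). Given N, pick such an n with N / X^k in a fixed range
   far from 0; after removing that combination, divide by D X (c_0 + ... +
   c_(k-1)): the quotient t is large but bounded, and the remainder has the form
   D Q. The resulting coefficient of c_i is t D X + O(X) with t D large, so it
   lies between 2^(n+i-1) and a bounded multiple of it, and is a sum of
   boundedly many blocks of length n + i. For k = 1, where c_1 is absent,
   c_0 = 1 suffices. *)

(** * Sums of boundedly many binary powers *)

Definition sum_of_powers (k W N : nat) : Prop :=
  exists s : seq nat,
    [/\ size s <= W, forall x : nat, x \in s -> binary_power k x
      & N = \sum_(x <- s) x].

Lemma sum_of_powers_sum (k W n : nat) (F : 'I_n -> nat) :
  (forall i, sum_of_powers k W (F i)) ->
  sum_of_powers k (n * W) (\sum_(i < n) F i).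
Proof.
elim: n F => [|n IH] F hF; first by exists [::]; split; rewrite ?big_ord0 ?big_nil.
have [s [ss ps Fs]] := IH _ (fun i => hF (lift ord0 i)).
have [s0 [ss0 ps0 Fs0]] := hF ord0.
exists (s0 ++ s); split.
- by rewrite size_cat mulSn leq_add.
- by move=> x; rewrite mem_cat => /orP [/ps0|/ps].
- by rewrite big_cat big_ord_recl /= -Fs0 -Fs.
Qed.

Lemma sum_of_powers_mul_repunit (k m W b : nat) : 0 < k ->
  2 ^ m <= b <= W * 2 ^ m -> sum_of_powers k W (b * repunit k m.+1).
Proof.
move=> k0 /andP [lb ub]; have p0 : 0 < 2 ^ m by rewrite expn_gt0.
have q0 : 0 < b %/ 2 ^ m by rewrite divn_gt0.
pose c := repunit k m.+1.
have bp r : r < 2 ^ m -> binary_power k ((2 ^ m + r) * c).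
  move=> hr; apply/(binary_powerP _ k0); right; exists m.+1, (2 ^ m + r).
  by split=> //; rewrite subn1 leq_addr expnS mul2n -addnn ltn_add2l.
(* A single block absorbs the remainder of [b] modulo [2 ^ m] and stays below [2 ^ m.+1]. *)
exists ((2 ^ m + b %% 2 ^ m) * c :: nseq (b %/ 2 ^ m).-1 (2 ^ m * c)); split.
- rewrite /= size_nseq prednK // -(leq_pmul2r p0).
  exact: leq_trans (leq_divM _ _) ub.
- move=> x; rewrite inE => /orP [/eqP ->|]; first by apply: bp; rewrite ltn_mod.
  by rewrite mem_nseq => /andP [_ /eqP ->]; rewrite -[X in X * c]addn0; apply: bp.
- rewrite big_cons big_nseq iter_addn_0 {1}(divn_eq b (2 ^ m)).
  rewrite -/c -{1}(prednK q0); lia.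
Qed.

(** * Base-[X] digits and Vandermonde inversion *)

Lemma bounded_digits (X C k N : nat) : 0 < X -> 0 < C -> N < C * X ^ k.+1 ->
  exists2 e : nat -> nat, forall j, e j <= C * X
    & N = \sum_(j < k.+1) e j * X ^ j.
Proof.
move=> X0 C0; elim: k N => [|k IH] N hN.
  (* The leading digit is left unreduced, whence the bound [C * X]. *)
  exists (fun _ => N) => [_|]; first by rewrite -(expn1 X) ltnW.
  by rewrite big_ord1 muln1.
have /IH [e he eN] : N %/ X < C * X ^ k.+1.
  by rewrite ltn_divLR // -mulnA -expnSr.
exists (fun j => if j is j'.+1 then e j' else N %% X).
  case=> [|j] //; apply: leq_trans (ltnW (ltn_pmod _ X0)) _.
  by rewrite leq_pmull.
rewrite big_ord_recl /= muln1 {1}(divn_eq N X) addnC eN big_distrl /=.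
by congr (_ + _); apply: eq_bigr => j _; rewrite /bump /= -mulnA -expnSr.
Qed.

(* [repunit k (n + i)] is the [i]-th entry of the Vandermonde matrix of the
   nodes [2 ^ j] applied to the vector of the [(2 ^ n) ^ j]; the adjugate
   inverts it up to the determinant, uniformly in [n]. *)
Lemma repunit_inversion (k : nat) :
  exists (D : nat) (u : 'I_k -> 'I_k -> int), 0 < D /\
    forall n j, (\sum_(i < k) u j i * (repunit k (n + i))%:Z
                 = D%:Z * (2 ^ n)%:Z ^+ j)%R.
Proof.
pose a : 'rV[int]_k := (\row_j (2 ^ j)%:Z)%R.
pose V := Vandermonde k a.
exists (`|(\det V)%R|%N), (fun j i => sgz (\det V) * (\adj V) j i)%R; split.
  rewrite absz_gt0 det_Vandermonde; apply/prodf_neq0 => i _.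
  apply/prodf_neq0 => j ij; rewrite !mxE subr_eq0 eqz_nat eqn_exp2l //.
  by rewrite gtn_eqF.
move=> n j.
pose x : 'cV[int]_k := (\col_j (2 ^ n)%:Z ^+ j)%R.
have cE (i : 'I_k) : Posz (repunit k (n + i)) = ((V *m x)%R i ord0).
  rewrite mxE /repunit (big_morph Posz PoszD (erefl (Posz 0))).
  apply: eq_bigr => l _; rewrite !mxE -!rmorphXn /= -PoszM !natrXE.
  by rewrite -!expnM -expnD mulnDr mulnC addnC (mulnC l i).
have := congr1 (fun M : 'cV[int]_k => M j ord0) (mulmxA (\adj V)%R V x).
rewrite mul_adj_mx mul_scalar_mx !mxE => E.
rewrite (abszEsg (\det V)%R) -mulrA -E mulr_sumr; apply: eq_bigr => i _.
by rewrite cE mulrA.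
Qed.

(** * Residues of repunits *)

Lemma repunit_eqmod (k m m' d : nat) :
  2 ^ m = 2 ^ m' %[mod d] -> repunit k m = repunit k m' %[mod d].
Proof.
move=> h; rewrite /repunit; elim/big_ind2: _ => // [x y z t xy zt|i _].
  by rewrite -modnDm xy zt modnDm.
by rewrite !(mulnC i) !expnM -modnXm h modnXm.
Qed.

(** Since [totient g <= g <= D], the totient divides [D!], and Euler's theorem applies. *)
Lemma expn2_totient_fact (g D q : nat) : 0 < D -> g %| D -> odd g ->
  2 ^ (D`! * q) = 1 %[mod g].
Proof.
move=> D0 gD og; have g0 : 0 < g by case: g og {gD}.
have /dvdnP [z ->] : totient g %| D`!.
  apply: dvdn_fact; rewrite totient_gt0 g0 /=.
  apply: leq_trans (dvdn_leq D0 gD).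
  rewrite totient_count_coprime -[X in _ <= X]subn0 -[X in _ <= X]muln1.
  by rewrite -sum_nat_const_nat; apply: leq_sum => i _; apply: leq_b1.
rewrite mulnAC mulnC expnM -modnXm Euler_exp_totient ?coprime2n //.
by rewrite modnXm exp1n.
Qed.

Lemma odd_repunit (k n : nat) : 0 < k -> 0 < n -> odd (repunit k n).
Proof.
case: k => // k _ n0; rewrite /repunit big_ord_recl oddD /=.
elim/big_ind: _ => // [x y|i _]; first by rewrite oddD; do 2!case: odd.
by rewrite oddX muln_eq0 /= -[n == 0]negbK -lt0n n0.
Qed.

Lemma linear_combination_mod (D a b N : nat) :
  0 < D -> gcdn (gcdn D a) b %| N ->
  exists x y, N = x * a + y * b %[mod D].
Proof.
move=> D0 /dvdnP [z ->]; set h := gcdn D a.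
have h0 : 0 < h by rewrite gcdn_gt0 D0.
have [s _ /dvdnP [p hp]] := Bezoutl a D0.
have [t _ /dvdnP [q hq]] := Bezoutl b h0.
rewrite -/h in hp.
(* Both Bezout relations give negated multiples; [D.-1] plays -1 modulo [D]. *)
exists (z * q * s * D.-1), (z * t * D.-1).
rewrite -[LHS](modnMDl (z * (t * b + q * (s * a)))).
rewrite -[RHS](modnMDl (z * q * p)).
congr (_ %% D).
have e1 : z * q * p * D = z * (q * h) + z * q * (s * a).
  by rewrite -mulnA -hp; ring.
rewrite e1 -hq -{1}(prednK D0); ring.
Qed.

Lemma repunit_mod1 (k m d : nat) : 2 ^ m = 1 %[mod d] ->
  repunit k m = k %[mod d].
Proof.
move=> h; rewrite (@repunit_eqmod k m 0) // /repunit.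
by under eq_bigr do rewrite muln0; rewrite sum_nat_const card_ord muln1.
Qed.

Lemma repunit1 (k : nat) : repunit k 1 = 2 ^ k - 1.
Proof.
rewrite subn1 predn_exp mul1n /repunit.
by apply: eq_bigr => i _; rewrite muln1.
Qed.

Lemma repunits_residue (k D n N : nat) : 0 < k -> 0 < D -> 0 < n -> D`! %| n ->
  gcdn (2 ^ k - 1) k %| N ->
  exists2 r : 'I_k -> nat, forall i, r i < D
    & N = \sum_(i < k) r i * repunit k (n + i) %[mod D].
Proof.
case: k => [|[|k]] // _ D0 n0 Dn EN.
  exists (fun _ => N %% D) => [_|]; first exact: ltn_pmod.
  by rewrite big_ord1 /repunit big_ord1 muln1 modn_mod.
set K := k.+2 in EN *.
set g := gcdn (gcdn D (repunit K n)) (repunit K n.+1).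
have gD : g %| D by rewrite /g -gcdnA dvdn_gcdl.
have ga : g %| repunit K n by rewrite /g gcdnAC dvdn_gcdr.
have gb : g %| repunit K n.+1 by rewrite dvdn_gcdr.
have og : odd g by apply: dvdn_odd gb _; apply: odd_repunit.
have pn : 2 ^ n = 1 %[mod g].
  by case/dvdnP: Dn => q ->; rewrite mulnC (@expn2_totient_fact g D q).
have gE : g %| gcdn (2 ^ K - 1) K.
  rewrite dvdn_gcd; apply/andP; split; last first.
    by rewrite /dvdn -(@repunit_mod1 K n).
  (* As [2 ^ n.+1] is 2 modulo [g], [repunit K n.+1] reduces to [repunit K 1]. *)
  rewrite /dvdn -repunit1 -(@repunit_eqmod K n.+1) //.
  by rewrite expnS -modnMmr pn modnMmr.
have [x [y xy]] := @linear_combination_mod _ _ _ N D0 (dvdn_trans gE EN).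
exists (fun i => if i == 0 :> nat then x %% D else
                 if i == 1 :> nat then y %% D else 0) => [i|].
  by do 2?[case: ifP => _]; rewrite ?ltn_pmod.
rewrite 2!big_ord_recl big1 //= addn0 addn1 addn0 xy.
by rewrite -modnDm -modnMml -[in X in _ + X]modnMml modnDm.
Qed.

(** * Size estimates and choice of scale *)

Lemma sum_repunits_bounds (k n : nat) : 0 < k ->
  (2 ^ n) ^ k.-1 <= \sum_(i < k) repunit k (n + i)
    <= (k * (k * 2 ^ (k * k))) * (2 ^ n) ^ k.-1.
Proof.
case: k => // k _; apply/andP; split.
  rewrite big_ord_recl /repunit addn0; apply: leq_trans (leq_addr _ _).
  by rewrite big_ord_recr /= mulnC expnM leq_addl.
rewrite -!mulnA -[X in _ <= X * _]card_ord -sum_nat_const.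
apply: leq_sum => i _; rewrite -[X in _ <= X * _]card_ord -sum_nat_const.
apply: leq_sum => j _; rewrite -expnM -expnD leq_exp2l //=.
have := ltn_ord i; have := ltn_ord j; nia.
Qed.

(** The largest admissible [q] works. With [P = k * D!] and [n = D! * q], the power [2 ^ (P * q)] is
    [(2 ^ n) ^ k]. *)
Lemma exists_scale (A P N : nat) : 0 < A -> 0 < P -> A * 2 ^ P <= N ->
  exists2 q, 0 < q & A * 2 ^ (P * q) <= N < A * 2 ^ (P * q.+1).
Proof.
move=> A0 P0 hN.
have ex : exists q, A * 2 ^ (P * q) <= N by exists 1; rewrite muln1.
have bd q : A * 2 ^ (P * q) <= N -> q <= N.
  move=> h; apply: leq_trans h; apply: leq_trans (ltnW (ltn_expl q (isT : 1 < 2))) _.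
  apply: leq_trans (leq_pmull _ A0).
  by rewrite leq_exp2l // leq_pmull.
case: (ex_maxnP ex bd) => q hq mq; exists q.
  by apply: mq; rewrite muln1.
by rewrite hq ltnNge; apply/negP => /mq; rewrite ltnn.
Qed.

Lemma signed_repunit_representation (k : nat) : 0 < k ->
  exists D U : nat, 0 < D /\
    forall C n N, 0 < C -> N < C * (2 ^ n) ^ k ->
      exists2 v : 'I_k -> int, forall i, `|v i|%N <= U * C * 2 ^ n
        & (\sum_(i < k) v i * (repunit k (n + i))%:Z = (D * N)%:Z)%R.
Proof.
move=> k0; have [D [u [D0 hu]]] := repunit_inversion k.
(* The sum over all entries dominates the column sum that bounds each [v i]. *)
exists D, (\sum_(i < k) \sum_(j < k) `|u j i|%N); split=> // C n N C0.
case: k k0 u hu => // k _ u hu hN.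
have X0 : 0 < 2 ^ n by rewrite expn_gt0.
have [e he eN] := @bounded_digits _ _ _ _ X0 C0 hN.
exists (fun i => \sum_(j < k.+1) u j i * (e j)%:Z)%R => [i|].
  rewrite -mulnA [X in _ <= X * _](bigD1 i) //= mulnDl; apply: leq_trans (leq_addr _ _).
  rewrite big_distrl /=.
  apply: (big_ind2 (fun (a : int) m => `|a|%N <= m)) => // [a x b y ax yb|j _].
    by apply: leq_trans (leq_add ax yb); lia.
  by rewrite abszM; apply: leq_mul (leqnn _) (he j).
under eq_bigr do rewrite mulr_suml.
rewrite exchange_big /= PoszM eN (big_morph Posz PoszD (erefl (Posz 0))) mulr_sumr.
apply: eq_bigr => j _.
under eq_bigr do rewrite mulrAC.
rewrite -mulr_suml hu PoszM -!natrXE !rmorphXn /=; ring.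
Qed.

Lemma absz_perturb (a c w : nat) (z : int) : `|z|%N <= w -> w + c <= a ->
  [/\ Posz `|(Posz a + z)%R| = (Posz a + z)%R, c <= `|(Posz a + z)%R|
    & `|(Posz a + z)%R| <= a + w].
Proof. by move=> zw wca; split; lia. Qed.

Theorem theorem4 (k : nat) (hk : 1 <= k) :
  exists W N0 : nat,
    0 < W /\
    forall N : nat, gcdn (2 ^ k - 1) k %| N -> N0 < N ->
      exists s : seq nat,
        [/\ size s <= W,
            forall x : nat, x \in s -> binary_power k x
          & N = \sum_(x <- s) x].
Proof.
have [D [U [D0 hU]]] := @signed_repunit_representation k hk.
have hS n := @sum_repunits_bounds k n hk.
set C := k * (k * 2 ^ (k * k)) in hS.
have C0 : 0 < C by rewrite !muln_gt0 hk expn_gt0.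
clearbody C.
(* In [T], [U * C] absorbs the signed corrections and [2 ^ k] keeps each coefficient at least
   [2 ^ k * X]. The extra 1 in [T.+1] pays for subtracting [R <= M]. *)
pose T := U * C + 2 ^ k; pose A := T.+1 * D * C.
have A0 : 0 < A by rewrite muln_gt0 C0 muln_gt0 D0.
pose B := A * 2 ^ (k * D`!).
(* The three terms bound [r i], [t * D * X] and [v i] in units of [X]; the 2 is for
   [X <= 2 * 2 ^ (n + i).-1], tight at [i = 0]. *)
pose W := 2 * (D + B * D + U * C).
exists (k * W), B; split.
  by rewrite !muln_gt0 hk !addn_gt0 D0.
move=> N EN /ltnW hN.
have P0 : 0 < k * D`! by rewrite muln_gt0 hk fact_gt0.
have [q q0 /andP [lN uN]] := @exists_scale A _ N A0 P0 hN.
pose n := D`! * q; pose X := 2 ^ n.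
have n0 : 0 < n by rewrite muln_gt0 fact_gt0.
have X0 : 0 < X by rewrite expn_gt0.
have XkE : X ^ k = X * X ^ k.-1 by rewrite -expnS prednK.
have Xk : 2 ^ (k * D`! * q) = X ^ k by rewrite -expnM -mulnA [k * _]mulnC.
have {}uN : N < B * X ^ k.
  by rewrite -Xk /B -mulnA -expnD -mulnS.
rewrite {}Xk in lN.
have [r rD rN] := @repunits_residue k D n N hk D0 n0 (dvdn_mulr _ (dvdnn _)) EN.
set R := \sum_(i < k) _ in rN.
have [lS uS] := andP (hS n).
set S := \sum_(i < k) _ in lS uS; rewrite -/X in lS uS.
have RS : R <= D * S.
  by rewrite big_distrr; apply: leq_sum => i _; rewrite leq_mul2r ltnW ?orbT.
have S0 : 0 < S by apply: leq_trans lS; rewrite expn_gt0 X0.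
pose M := D * (X * S).
have XS : X * S <= C * X ^ k by rewrite XkE mulnCA leq_mul2l uS orbT.
have M0 : 0 < M by rewrite !muln_gt0 D0 X0.
have RM : R <= M by apply: leq_trans RS _; rewrite leq_mul2l leq_pmull ?orbT.
have TM : T.+1 * M <= N.
  by apply: leq_trans lN; rewrite /A -mulnA -mulnA; do 2!apply: leq_mul => //.
have RN : R <= N by apply: leq_trans RM _; apply: leq_trans TM; apply: leq_pmull.
pose t := (N - R) %/ M.
have lt : T <= t.
  by rewrite leq_divRL // leq_subRL //; apply: leq_trans TM; rewrite mulSn leq_add2r.
have ut : t <= B.
  have Xk0 : 0 < X ^ k by rewrite expn_gt0 X0.
  rewrite -(leq_pmul2r Xk0); apply: leq_trans (ltnW uN).
  apply: leq_trans (leq_subr R N); apply: leq_trans (leq_divM _ M).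
  rewrite leq_mul2l XkE; apply/orP; right.
  by apply: leq_trans (leq_pmull _ D0); rewrite leq_mul2l lS orbT.
(* [D] divides both [M] and [N - R], hence the remainder. *)
have /dvdnP [Q hQ] : D %| (N - R) %% M.
  rewrite /dvdn modn_dvdm ?dvdn_mulr // -/(dvdn _ _) -eqn_mod_dvd //.
  exact/eqP.
have QX : Q < C * X ^ k.
  apply: leq_trans XS; rewrite -(ltn_pmul2l D0) mulnC -hQ.
  exact: ltn_pmod.
have [v vU vE] := hU _ _ _ C0 QX; rewrite -/X in vU.
have tX : U * C * X + 2 ^ k * X <= t * D * X.
  rewrite -mulnDl leq_mul2r; apply/orP; right.
  by apply: leq_trans lt _; apply: leq_pmulr.
pose b i := `|(Posz (r i + t * D * X)%N + v i)%R|%N.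
have hb i : [/\ Posz (b i) = (Posz (r i + t * D * X)%N + v i)%R,
    2 ^ k * X <= b i & b i <= r i + t * D * X + U * C * X].
  apply: absz_perturb (vU i) _; apply: leq_trans tX _; exact: leq_addl.
have -> : N = \sum_(i < k) b i * repunit k (n + i).
  apply/eqP; rewrite -eqz_nat (big_morph Posz PoszD (erefl (Posz 0))).
  under eq_bigr => i _.
    have [bE _ _] := hb i; rewrite PoszM bE mulrDl; over.
  rewrite big_split /= vE.
  under eq_bigr do rewrite -PoszM mulnDl.
  rewrite -(big_morph Posz PoszD (erefl (Posz 0))) big_split -big_distrr /=.
  rewrite -/R -/S -PoszD eqz_nat -{1}(subnKC RN) {1}(divn_eq (N - R) M) -/t hQ.
  by apply/eqP; rewrite /M; ring.
apply: sum_of_powers_sum => i; have [_ lb ub] := hb i.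
have ni : n + i = (n + i).-1.+1 by rewrite prednK // addn_gt0 n0.
rewrite ni; apply: sum_of_powers_mul_repunit hk _; apply/andP; split.
  apply: leq_trans lb; rewrite -expnD leq_exp2l //.
  by apply: leq_trans (leq_pred _) _; rewrite addnC leq_add2r ltnW.
have X2 : X <= 2 * 2 ^ (n + i).-1 by rewrite -expnS -ni leq_exp2l // leq_addr.
rewrite /W [2 * _]mulnC -mulnA; apply: leq_trans (leq_mul (leqnn _) X2).
apply: leq_trans ub _; rewrite !mulnDl leq_add2r leq_add //.
  by apply: leq_trans (ltnW (rD i)) _; apply: leq_pmulr.
by rewrite !leq_mul2r ut !orbT.
Qed.
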